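(* Consider the projection-constrained nonlinear opinion dynamics $$\dot{\boldsymbol{Z}}_i = P_i\,\mathbf{F}_i(\boldsymbol{Z}),\qquad F_{ij}(\boldsymbol{Z}) = -d z_{ij} + S\Big(u\big(\alpha z_{ij} + \gamma \sum_{k\neq i} (A_{\rm a})_{ik} z_{kj}\big)\Big) + b_{ij},$$ for $i\in\{1,\dots,N_{\rm a}\}$, $j\in\{1,\dots,N_{\rm o}\}$, where $P_i\in\mathbb{R}^{N_{\rm o}\times N_{\rm o}}$ is an orthogonal projection matrix, and suppose that $P_i$ has rank $k\ge 1$. Then $\operatorname{range} P_i = \ker P_i^{\perp}$, where $P_i^\perp = I - P_i$, is invariant under the flow of this system; that is, if $\boldsymbol{Z}_i(0)\in \ker P_i^\perp$ then $\boldsymbol{Z}_i(t)\in\ker P_i^\perp$ for all $t\ge 0$.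
   Context: There are $N_{\rm a}$ agents and $N_{\rm o}$ options. $z_{ij}\in\mathbb{R}$ is the opinion of agent $i$ on option $j$; $\boldsymbol{Z}_i=(z_{i1},\dots,z_{iN_{\rm o}})^T\in\mathbb{R}^{N_{\rm o}}$; $\boldsymbol{Z}=(\boldsymbol{Z}_1^T,\dots,\boldsymbol{Z}_{N_{\rm a}}^T)^T$ is the network state; $\mathbf{F}_i=(F_{i1},\dots,F_{iN_{\rm o}})^T$. The matrix $A_{\rm a}\in\mathbb{R}^{N_{\rm a}\times N_{\rm a}}$ is the adjacency matrix of an undirected connected unweighted graph without self-loops: it is symmetric and irreducible, with entries in $\{0,1\}$ and zero diagonal. $S:\mathbb{R}\to\mathbb{R}$ is an odd sigmoidal saturating function with $S(0)=0$, $S'(0)=1$, $\operatorname{sign}(S''(z))=-\operatorname{sign}(z)$. Parameters: $u>0$, $d>0$, $\gamma>0$, $\alpha>0$, $b_{ij}\in\mathbb{R}$. *)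

(* Defs.v *)
From HB Require Import structures.
From mathcomp Require Import all_boot all_order all_algebra.
From mathcomp Require Import all_classical all_reals all_analysis.

Set Implicit Arguments.
Unset Strict Implicit.
Unset Printing Implicit Defensive.

Import Order.TTheory GRing.Theory Num.Theory.
Import numFieldNormedType.Exports.

Local Open Scope classical_set_scope.
Local Open Scope ring_scope.

(* The graph is undirected, so its connectedness is the irreducibility of A. *)
Definition is_connected_adjacency (R : realType) (Na : nat) (A : 'M[R]_Na) :=
  [/\ A^T = A,
      forall i k, A i k = 0 \/ A i k = 1,
      forall i, A i i = 0 &
      forall i k, connect [rel p q | A p q == 1] i k].

(* "Sigmoidal" is read as strictly increasing, "saturating" as having finite
   limits at both infinities. *)
Record odd_sigmoid (R : realType) (S : R -> R) : Prop := OddSigmoid {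
  sigmoid_derivable : forall z, derivable S z 1;
  sigmoid_derivable2 : forall z, derivable (derive1 S) z 1;
  sigmoid_odd : forall z, S (- z) = - S z;
  sigmoid_increasing : forall x y, x < y -> S x < S y;
  sigmoid_saturating : cvg (S z @[z --> +oo]) /\ cvg (S z @[z --> -oo]);
  sigmoid0 : S 0 = 0;
  sigmoid_deriv0 : derive1 S 0 = 1;
  sigmoid_deriv2_sg : forall z, Num.sg (derive1 (derive1 S) z) = - Num.sg z
}.

Definition orthogonal_projection (R : realType) (n : nat) (P : 'M[R]_n) :=
  P *m P = P /\ P^T = P.

(* Column-vector conventions; [kermx] and [<=]%MS act on row vectors instead. *)
Definition mx_range (R : realType) (n : nat) (P : 'M[R]_n) : set 'cV[R]_n :=
  range (fun v : 'cV[R]_n => P *m v).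

Definition mx_ker (R : realType) (n : nat) (P : 'M[R]_n) : set 'cV[R]_n :=
  [set v | P *m v = 0].

(* [Z i] is the opinion vector of agent i, so z_ij is [Z i j 0]. *)
Definition opinion_state (R : realType) (Na No : nat) := 'I_Na -> 'cV[R]_No.

Definition opinion_field (R : realType) (Na No : nat) (A : 'M[R]_Na)
    (S : R -> R) (u d gamma alpha : R) (b : 'I_Na -> 'I_No -> R)
    (Z : opinion_state R Na No) (i : 'I_Na) : 'cV[R]_No :=
  \col_(j < No)
    (- d * Z i j 0
     + S (u * (alpha * Z i j 0 + gamma * \sum_(k < Na | k != i) A i k * Z k j 0))
     + b i j).

Definition projected_field (R : realType) (Na No : nat)
    (P : 'I_Na -> 'M[R]_No)
    (F : opinion_state R Na No -> 'I_Na -> 'cV[R]_No)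
    (Z : opinion_state R Na No) (i : 'I_Na) : 'cV[R]_No :=
  P i *m F Z i.

(* A trajectory on [0, +oo[; at the endpoint only continuity is asked, which,
   for a continuous G, forces the right derivative there to be G (Z 0). *)
Definition is_solution (R : realType) (Na No : nat)
    (G : opinion_state R Na No -> 'I_Na -> 'cV[R]_No)
    (Z : R -> opinion_state R Na No) :=
  forall i : 'I_Na,
    {within `[0, +oo[%classic, continuous (fun t => Z t i)} /\
    forall t : R, 0 < t -> is_derive t 1 (fun s => Z s i) (G (Z t) i).

Definition flow_invariant (R : realType) (Na No : nat)
    (G : opinion_state R Na No -> 'I_Na -> 'cV[R]_No)
    (M : set (opinion_state R Na No)) :=
  forall Z : R -> opinion_state R Na No, is_solution G Z ->
    M (Z 0) -> forall t : R, 0 <= t -> M (Z t).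

(* Main.v *)
Require Import Defs.
From HB Require Import structures.
From mathcomp Require Import all_boot all_order all_algebra.
From mathcomp Require Import all_classical all_reals all_analysis.

Set Implicit Arguments.
Unset Strict Implicit.
Unset Printing Implicit Defensive.

Import Order.TTheory GRing.Theory Num.Theory.
Import numFieldNormedType.Exports.

Local Open Scope classical_set_scope.
Local Open Scope ring_scope.

(** Put [Q = 1 - P i]. Idempotence of [P i] gives [Q *m P i = 0], so [Q]
    annihilates the velocity [P i *m F_i(Z)] of agent i at every state. Hence
    [Q *m Z_i(t)] is a first integral ([mulmx_conserved]): each of its entries
    is a real function, continuous on the closed half-line, with zero
    derivative at positive times, and the mean value theorem makes it constant
    ([constant_on_halfline]). If [Q *m Z_i] vanishes at time 0, it vanishes at
    all later times. *)

(** The pointwise-sum form lets the continuity and derivative rules for sums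
    and scalings of functions apply. *)
Lemma mulmx_entryE (R : realType) (T : Type) (m n p : nat) (Q : 'M[R]_(m, n))
    (M : T -> 'M[R]_(n, p)) (i : 'I_m) (j : 'I_p) :
  (fun x => (Q *m M x) i j) = \sum_(l < n) (Q i l \*: (fun x => M x l j)).
Proof. by apply/funext => x; rewrite mxE fct_sumE. Qed.

Lemma mulmx_entry_continuous (R : realType) (m n p : nat) (Q : 'M[R]_(m, n))
    (i : 'I_m) (j : 'I_p) :
  continuous (fun M : 'M[R]_(n, p) => (Q *m M) i j).
Proof.
rewrite (mulmx_entryE Q id).
elim/big_ind : _ => [|f g cf cg|l _] M; first exact: cst_continuous.
- by apply: continuousD; [exact: cf|exact: cg].
- by apply: continuousZl_tmp; exact: coord_continuous.
Qed.

Lemma is_derive_mulmx_entry (R : realType) (V : normedModType R) (m n p : nat)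
    (Q : 'M[R]_(m, n)) (M : V -> 'M[R]_(n, p)) (t v : V) (dM : 'M[R]_(n, p))
    (i : 'I_m) (j : 'I_p) :
  is_derive t v M dM ->
  is_derive t v (fun s => (Q *m M s) i j) ((Q *m dM) i j).
Proof.
move=> [derM <-].
have dMl l : is_derive t v (fun s => M s l j) ('D_v M t l j).
  by rewrite derive_mx // mxE; apply: DeriveDef => //; exact: (derivable_mxP M t v).1.
by rewrite mulmx_entryE mxE; apply: is_derive_sum => l; exact: is_deriveZ.
Qed.

(** Mean value theorem on [0, t]: continuity at 0 carries the zero increment
    from the open interval to the initial time. *)
Lemma constant_on_halfline (R : realType) (f : R -> R) :
  {within `[0, +oo[%classic, continuous f} ->
  (forall t : R, 0 < t -> is_derive t 1 f 0) ->
  forall t : R, 0 <= t -> f t = f 0.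
Proof.
move=> cf df t t0.
have [s||c _] := @MVT_segment R f (fun=> 0) 0 t t0.
- by rewrite in_itv /= => /andP[s0 _]; exact: df.
- apply: continuous_subspaceW cf => s /=.
  by rewrite !in_itv /= andbT => /andP[].
- by rewrite mul0r => /subr0_eq.
Qed.

(** Differentiating entry by entry, since the mean value theorem holds only for
    real-valued functions. *)
Lemma mulmx_conserved (R : realType) (m n p : nat) (Q : 'M[R]_(m, n))
    (M dM : R -> 'M[R]_(n, p)) :
  {within `[0, +oo[%classic, continuous M} ->
  (forall t : R, 0 < t -> is_derive t 1 M (dM t)) ->
  (forall t, Q *m dM t = 0) ->
  forall t : R, 0 <= t -> Q *m M t = Q *m M 0.
Proof.
move=> cM derM QdM t t0; apply/matrixP => i j.
apply: (@constant_on_halfline R (fun s => (Q *m M s) i j)) => // [|s s0].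
- apply: (@within_continuous_comp _ _ _ _ M (fun N => (Q *m N) i j)) cM.
  by move=> N _; exact: mulmx_entry_continuous.
- have := is_derive_mulmx_entry Q i j (derM _ s0).
  by rewrite QdM mxE.
Qed.

(** A vector in the range is fixed by [P], and a vector fixed by [P] is its own
    preimage. *)
Lemma idempotent_range_ker (R : realType) (n : nat) (P : 'M[R]_n) :
  P *m P = P -> mx_range P = mx_ker (1%:M - P).
Proof.
move=> PP; apply/seteqP; split => v; rewrite /mx_range /mx_ker /=.
- by move=> [w _ <-]; rewrite mulmxBl mul1mx mulmxA PP subrr.
- by rewrite mulmxBl mul1mx => /subr0_eq vE; exists v.
Qed.

Theorem mainTheorem1 (R : realType) (Na No : nat)
    (A : 'M[R]_Na) (hA : is_connected_adjacency A)
    (S : R -> R) (hS : odd_sigmoid S)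
    (u d gamma alpha : R)
    (hu : 0 < u) (hd : 0 < d) (hgamma : 0 < gamma) (halpha : 0 < alpha)
    (b : 'I_Na -> 'I_No -> R)
    (P : 'I_Na -> 'M[R]_No) (hP : forall l, orthogonal_projection (P l))
    (i : 'I_Na) (k : nat) (hk : (1 <= k)%N) (hrank : \rank (P i) = k) :
  mx_range (P i) = mx_ker (1%:M - P i) /\
  flow_invariant
    (projected_field P (opinion_field A S u d gamma alpha b))
    [set Z : opinion_state R Na No | mx_ker (1%:M - P i) (Z i)].
Proof.
have [PP _] := hP i; split; first exact: idempotent_range_ker.
move=> Z solZ; rewrite /mx_ker /= => Z0 t t0.
have [cZ derZ] := solZ i.
rewrite -Z0; apply: (mulmx_conserved cZ derZ) t0 => s.
by rewrite /projected_field mulmxA mulmxBl mul1mx PP subrr mul0mx.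
Qed.
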